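(* Let $n,r$ be positive integers. Every non-trivial block of the block diagonal form of $H_{I}$ or of $H_{II}$ is of the form $\begin{pmatrix}0&1\\-1&0\end{pmatrix}$.
   Context: $N_r$ is the $r\times r$ matrix with all entries on and above the diagonal equal to $-1$ and zeros below the diagonal; $M_r=-N_r^t$. For $r\times r$ integer matrices $A,M$ with $A^t=-A$, put $N=-M^t$ and let $H(A,M)$ be the $nr\times nr$ matrix of $n\times n$ blocks of size $r\times r$ with diagonal blocks $A$, all blocks above the diagonal equal to $M$ and all blocks below the diagonal equal to $N$. Then $H_{I}=H(M_r+N_r,\,M_r)$ (case ''Combined I'') and $H_{II}=H(M_r+N_r,\,N_r)$ (case ''Combined II''). A block diagonal form of a skew-symmetric integer matrix $J$ of size $N$ and corank $c$ is a matrix $L^tJL=\operatorname{Diag}(D_1,\dots,D_k,0,\dots,0)$, with $L$ an integer matrix of determinant $\pm1$, $k=\tfrac12(N-c)$, and each $D_i=\begin{pmatrix}0&h_i\\-h_i&0\end{pmatrix}$ nonzero (a ''non-trivial block''); blocks are considered up to the sign of $h_i$. *)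

(* Defs.v *)
From HB Require Import structures.
From mathcomp Require Import all_boot all_order all_algebra.

Set Implicit Arguments.
Unset Strict Implicit.
Unset Printing Implicit Defensive.

Import GRing.Theory Num.Theory.
Local Open Scope ring_scope.

Definition Nmx (r : nat) : 'M[int]_r :=
  \matrix_(i < r, j < r) (if (i <= j)%N then -1 else 0).

Definition Mmx (r : nat) : 'M[int]_r := - (Nmx r)^T.

(* [\sum_(i < n) r] is the index size that [\mxblock] produces for an n x n
   array of r x r blocks; it equals n * r. *)
Definition Hmx (n r : nat) (A M : 'M[int]_r) : 'M[int]_(\sum_(i < n) r) :=
  \mxblock_(i < n, j < n)
    (if (i < j)%N then M else if (j < i)%N then - M^T else A).

Definition H_I (n r : nat) : 'M[int]_(\sum_(i < n) r) :=
  Hmx n (Mmx r + Nmx r) (Mmx r).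

Definition H_II (n r : nat) : 'M[int]_(\sum_(i < n) r) :=
  Hmx n (Mmx r + Nmx r) (Nmx r).

Definition corank (N : nat) (J : 'M[int]_N) : nat :=
  (N - \rank (map_mx (intr : int -> rat) J))%N.

Definition skew_block (h : int) : 'M[int]_2 :=
  \matrix_(i < 2, j < 2)
    (if (i < j)%N then h else if (j < i)%N then - h else 0).

Definition diag_skew (k c : nat) (h : 'I_k -> int) :
    'M[int]_(\sum_(i < k) 2 + c) :=
  block_mx (\mxdiag_(i < k) skew_block (h i)) 0 0 0.

(* The size equation [e] says 2 * k + c = N with c the corank of J,
   i.e. k = (N - c) / 2. No divisibility between the h i is required. *)
Definition is_block_diagonal_form (N : nat) (J L : 'M[int]_N)
    (k : nat) (h : 'I_k -> int) : Prop :=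
  [/\ \det L = 1 \/ \det L = -1,
      forall i : 'I_k, skew_block (h i) != 0 &
      exists e : (\sum_(i < k) 2 + corank J)%N = N,
        L^T *m J *m L = castmx (e, e) (diag_skew (corank J) h)].

(* Main.v *)
(* A kernel vector of J modulo d lifts to an integer kernel vector; this property
   survives unimodular congruence, and applied with d = h_i to the second basis
   vector of the i-th block it forces h_i to be invertible.

   To lift, read a vector as an n x r array x.  Then (J x)(i, a) is the sum of x
   over {j >= i, b <= a} minus its sum over {j <= i, b >= a} (for H_II, after
   reversing the order of the blocks).  Mixed differences of these quantities
   show that, modulo d, x(i, a) = f(i + a + 1) for a sequence f on {0, ..., n + r}
   all of whose windows of length n + 1 or r + 1 sum to 0.  The Euclidean algorithm
   on (n + 1, r + 1) lifts such a sequence to the integers. *)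

Require Import Defs.
From HB Require Import structures.
From mathcomp Require Import all_boot all_order all_algebra.
From mathcomp Require Import zify ring.

Set Implicit Arguments.
Unset Strict Implicit.
Unset Printing Implicit Defensive.

Import GRing.Theory Num.Theory.
Local Open Scope ring_scope.

(** * Sequences with vanishing window sums *)

Definition window (f : nat -> int) (s k : nat) : int := \sum_(t < k) f (s + t)%N.

Lemma window0 f s : window f s 0 = 0.
Proof. exact: big_ord0. Qed.

Lemma windowS f s k : window f s k.+1 = window f s k + f (s + k)%N.
Proof. exact: big_ord_recr. Qed.

Lemma windowSl f s k : window f s k.+1 = f s + window f s.+1 k.
Proof.
rewrite /window big_ord_recl addn0; congr (_ + _).
by apply: eq_bigr => t _; rewrite /= /bump /= addnA addn1.
Qed.

Lemma windowD f s k l : window f s (k + l) = window f s k + window f (s + k) l.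
Proof.
elim: l => [|l IHl]; first by rewrite addn0 window0 addr0.
by rewrite addnS !windowS IHl addnA addrA.
Qed.

Lemma eq_window f g s k :
  (forall t, (t < s + k)%N -> f t = g t) -> window f s k = window g s k.
Proof. by move=> fg; apply: eq_bigr => t _; rewrite fg // ltn_add2l. Qed.

(** Each new window determines its last entry as minus the sum of the others. The bound on [t]
    preserves every entry before the last one of the first new window. *)
Lemma window_extend f p q m : (0 < p)%N ->
    (forall s, (s < q)%N -> window f s p = 0) ->
  exists2 g, forall t, (t.+1 < p + q)%N -> g t = f t
           & forall s, (s < q + m)%N -> window g s p = 0.
Proof.
case: p => // p _ f0; elim: m => [|m [g gf g0]].
  by exists f => // s; rewrite addn0; apply: f0.
exists (fun t => if t == (q + m + p)%N then - window g (q + m) p else g t).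
  by move=> t lt_t; rewrite ifN ?gf //; lia.
move=> s; rewrite addnS ltnS leq_eqVlt => /predU1P[-> | lt_s].
  rewrite windowS eqxx (@eq_window _ g) ?subrr // => t lt_t.
  by rewrite ifN // neq_ltn lt_t.
rewrite (@eq_window _ g) ?g0 // => t lt_t.
by rewrite ifN //; lia.
Qed.

(* Euclidean algorithm: for p <= q, windows of length q are windows of length
   q - p followed by windows of length p. *)
Lemma window_lift (S : zmodClosed int) f p q :
    (forall s, (s < q)%N -> window f s p \in S) ->
    (forall s, (s < p)%N -> window f s q \in S) ->
  exists g, [/\ forall t, (t.+1 < p + q)%N -> f t - g t \in S,
                forall s, (s < q)%N -> window g s p = 0
              & forall s, (s < p)%N -> window g s q = 0].
Proof.
have [N] := ubnP (p + q)%N; elim: N => // N IHN in p q *.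
wlog le_pq : p q / (p <= q)%N => [wlog_pq | ].
  have [/wlog_pq // | /ltnW le_qp] := leqP p q.
  rewrite addnC => ltN fp fq; have [g [fg gq gp]] := wlog_pq _ _ le_qp ltN fq fp.
  by exists g; split=> // t; rewrite addnC; apply: fg.
case: (posnP p) => [-> _ _ _ | p_gt0].
  exists f; split=> // [t _ | s _]; first by rewrite subrr rpred0.
  exact: window0.
rewrite -(subnKC le_pq); set q' := (q - p)%N; clearbody q'.
rewrite ltnS => ltN fp fq.
have fq' s : (s < p)%N -> window f s q' \in S.
  move=> lt_s; have := fq s lt_s; rewrite addnC windowD rpredDr //.
  by apply: fp; lia.
have [||g0 [fg0 g0p g0q]] := IHN p q' _ _ fq'; first by lia.
  by move=> s lt_s; apply: fp; lia.
(* The induction controls windows of length [p] only up to start [q']; [p] further windows reach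
   every start below [p + q']. *)
have [g gg0 gp] := window_extend p p_gt0 g0p.
exists g; split=> [|s lt_s|s lt_s].
- elim/ltn_ind=> t IHt lt_t; case: (ltnP t.+1 (p + q')) => [lt_t' | le_t].
    by rewrite gg0 // fg0.
  (* Here [t] ends a window of length [p] whose earlier entries are congruent by induction; both
     window sums lie in [S], so the last entries are congruent too. *)
  have [s Es] : exists s, (s + p.-1 = t)%N by exists (t - p.-1)%N; lia.
  have fps : window f s p \in S by apply: fp; lia.
  have gps : window g s p = 0 by apply: gp; lia.
  have Ep : p = p.-1.+1 by rewrite prednK.
  have {fps gps} : window f s p - window g s p \in S by rewrite gps subr0.
  rewrite Ep !windowS Es opprD addrACA rpredDl // /window -sumrB.
  by apply: rpred_sum => i _; apply: IHt; have := ltn_ord i; lia.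
- by apply: gp; lia.
rewrite addnC windowD gp ?addr0; last by lia.
by rewrite -[RHS](g0q s lt_s); apply: eq_window => t lt_t; apply: gg0; lia.
Qed.

(** * Corner sums of an array and their reduction to windows *)

Definition corner (n r : nat) (x : nat -> nat -> int) (i a : nat) : int :=
  \sum_(i <= j < n) \sum_(0 <= b < a.+1) x j b
  - \sum_(0 <= j < i.+1) \sum_(a <= b < r) x j b.

Lemma corner_row_diff n r x i a : (i.+1 < n)%N ->
  corner n r x i a - corner n r x i.+1 a =
    \sum_(0 <= b < a.+1) x i b + \sum_(a <= b < r) x i.+1 b.
Proof.
move=> lt_in; rewrite /corner (big_ltn (ltnW lt_in)).
by rewrite [\sum_(0 <= j < i.+2) _](big_nat_recr i.+1) //=; ring.
Qed.

(** In two adjacent columns the row differences share all but two terms. Hence corner sums in [S]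
    force [x] to be constant along antidiagonals modulo [S]. *)
Lemma corner_antidiag n r x i a : (i.+1 < n)%N -> (a.+1 < r)%N ->
  x i.+1 a - x i a.+1 =
    (corner n r x i a - corner n r x i.+1 a)
    - (corner n r x i a.+1 - corner n r x i.+1 a.+1).
Proof.
move=> lt_in lt_ar; rewrite !corner_row_diff //.
rewrite (big_ltn (ltnW lt_ar)) [\sum_(0 <= b < a.+2) _](big_nat_recr a.+1) //=; ring.
Qed.

(** Once [x j b] depends only on [j + b], the right-hand side is a window of length [n + 1].
    Likewise [corner_row_diff] at [a = 0] yields windows of length [r + 1]. *)
Lemma corner_col_diff n r x a : (0 < n)%N -> (a.+1 < r)%N ->
  corner n r x 0 a.+1 - corner n r x 0 a =
    x 0%N a + \sum_(0 <= j < n) x j a.+1.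
Proof.
move=> n_gt0 lt_ar; rewrite /corner !big_nat1 (big_ltn (ltnW lt_ar)).
have -> : \sum_(0 <= j < n) \sum_(0 <= b < a.+2) x j b =
    \sum_(0 <= j < n) (\sum_(0 <= b < a.+1) x j b + x j a.+1).
  by apply: eq_bigr => j _; rewrite (big_nat_recr a.+1).
by rewrite big_split /=; ring.
Qed.

(** Together with [corner_last], this serves the two end windows, which the row and column
    differences do not reach. *)
Lemma corner_first n r x : (0 < n)%N ->
  corner n r x 0 0 = \sum_(0 <= j < n) x j 0%N - \sum_(0 <= b < r) x 0%N b.
Proof.
by move=> n_gt0; rewrite /corner big_nat1; under eq_bigr do rewrite big_nat1.
Qed.

Lemma corner_last n r x :
  corner n.+1 r.+1 x n r =
    \sum_(0 <= b < r.+1) x n b - \sum_(0 <= j < n.+1) x j r.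
Proof. by rewrite /corner big_nat1; under [in X in _ - X]eq_bigr do rewrite big_nat1. Qed.

(* Both terms are sums of [f (j + b)] over complementary rectangles of
   [0, n] x [0, r], an array whose rows and columns all sum to 0. *)
Lemma corner_window0 n r f i a :
    (forall s, (s <= r)%N -> window f s n.+1 = 0) ->
    (forall s, (s <= n)%N -> window f s r.+1 = 0) ->
    (i < n)%N -> (a < r)%N ->
  corner n r (fun j b => f (j + b).+1) i a = 0.
Proof.
move=> fn fr lt_in lt_ar.
have rows : \sum_(0 <= j < i.+1) \sum_(0 <= b < r.+1) f (j + b)%N = 0.
  rewrite big_nat_cond big1 // => j; rewrite andbT /= => lt_j.
  by rewrite big_mkord -[RHS](fr j) //; lia.
have cols : \sum_(0 <= j < n.+1) \sum_(0 <= b < a.+1) f (j + b)%N = 0.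
  rewrite exchange_big big_nat_cond big1 // => b; rewrite andbT /= => lt_b.
  rewrite big_mkord -[RHS](fn b) //; last by lia.
  by apply: eq_bigr => t _; rewrite addnC.
move: rows; under eq_bigr do rewrite (@big_cat_nat _ _ _ a.+1) //= 1?ltnW //.
move: cols; rewrite (@big_cat_nat _ _ _ i.+1) //= ?ltnS 1?ltnW //.
rewrite big_split /= => cols rows.
(* The successor in [f (j + b).+1] is absorbed into [j] in the first rectangle and into [b] in the
   second. The rectangle [[0, i] x [0, a]] then completes one to full columns and the other to full
   rows. *)
rewrite /corner (_ : \sum_(i <= j < n) _ =
    \sum_(i.+1 <= j < n.+1) \sum_(0 <= b < a.+1) f (j + b)%N); last first.
  by rewrite big_add1.
rewrite (_ : \sum_(0 <= j < i.+1) \sum_(a <= b < r) _ =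
    \sum_(0 <= j < i.+1) \sum_(a.+1 <= b < r.+1) f (j + b)%N); last first.
  by apply: eq_bigr => j _; rewrite big_add1; apply: eq_bigr => b _; rewrite addnS.
by apply/eqP; rewrite subr_eq0 -(inj_eq (addrI (\sum_(0 <= j < i.+1)
  \sum_(0 <= b < a.+1) f (j + b)%N))) cols rows.
Qed.

(** With [S] the multiples of [d], this is the lifting of kernel vectors: modulo [S] the array
    becomes a sequence, [window_lift] corrects it, and the result is spread back over the
    antidiagonals. *)
Lemma corner_lift (S : zmodClosed int) n r x :
    (forall i a, (i < n)%N -> (a < r)%N -> corner n r x i a \in S) ->
  exists2 z, forall i a, (i < n)%N -> (a < r)%N -> corner n r z i a = 0
           & forall i a, (i < n)%N -> (a < r)%N -> x i a - z i a \in S.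
Proof.
case: n => [_|n]; first by exists x.
case: r => [_|r]; first by exists x.
move=> xS; have xB i a j b : (i < n.+1)%N -> (a < r.+1)%N -> (j < n.+1)%N ->
    (b < r.+1)%N -> corner n.+1 r.+1 x i a - corner n.+1 r.+1 x j b \in S.
  by move=> *; rewrite rpredB ?xS.
(* One representative per antidiagonal: down the first column, then along the last row. *)
pose phi t := x (minn t n) (t - n)%N.
have xphi a i : (i <= n)%N -> (a <= r)%N -> x i a - phi (i + a)%N \in S.
  elim: a i => [|a IHa] i le_in le_ar.
    by rewrite addn0 /phi (minn_idPl le_in) (eqP le_in) subrr rpred0.
  move: le_in; rewrite leq_eqVlt => /predU1P[-> | lt_in].
    by rewrite /phi (minn_idPr _) ?leq_addr // addKn subrr rpred0.
  have -> : x i a.+1 - phi (i + a.+1)%N =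
      (x i.+1 a - phi (i.+1 + a)%N) - (x i.+1 a - x i a.+1).
    by rewrite addSnnS; ring.
  rewrite rpredB ?IHa ?(ltnW le_ar) //.
  rewrite (@corner_antidiag n.+1 r.+1) // rpredB // xB //; lia.
(* The two end values are chosen so that the first and last windows of length
   n + 2 sum to 0 exactly. *)
pose f t := if t is t'.+1 then
    if (t' == n + r.+1)%N then - window phi r n.+1 else phi t'
  else - window phi 0 n.+1.
have fphi s k : (s + k <= n + r.+1)%N -> window f s.+1 k = window phi s k.
  move=> le_sk; apply: eq_bigr => t _; rewrite /f /= ifN //.
  by have := ltn_ord t; lia.
have flast : f (n + r.+1).+1 = - window phi r n.+1 by rewrite /f eqxx.
have row s k : (s <= n)%N -> (k <= r.+1)%N ->
    \sum_(0 <= b < k) x s b - window phi s k \in S.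
  move=> le_s le_k; rewrite big_mkord -sumrB; apply: rpred_sum => b _.
  by apply: xphi => //; have := ltn_ord b; lia.
have col s k : (s <= r)%N -> (k <= n.+1)%N ->
    \sum_(0 <= j < k) x j s - window phi s k \in S.
  move=> le_s le_k; rewrite big_mkord -sumrB; apply: rpred_sum => j _.
  by rewrite addnC; apply: xphi => //; have := ltn_ord j; lia.
have fn s : (s < r.+2)%N -> window f s n.+2 \in S.
  case: s => [_|s].
    by rewrite windowSl fphi /= ?addNr ?rpred0 //; lia.
  rewrite !ltnS leq_eqVlt => /predU1P[-> | lt_s].
    rewrite windowS fphi; last by lia.
    by rewrite (_ : (r.+1 + n.+1 = (n + r.+1).+1)%N) ?flast ?subrr ?rpred0 //; lia.
  rewrite fphi; last by lia.
  (* An interior window is an entry of the first row followed by the next column. *)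
  have : x 0 s + \sum_(0 <= j < n.+1) x j s.+1 \in S.
    by rewrite -(@corner_col_diff n.+1 r.+1) // xB // ltnW.
  have := xphi s 0 isT (ltnW lt_s); have := col s.+1 n.+1 lt_s (leqnn _).
  move=> colS phiS xS'; rewrite windowSl.
  have -> : phi s + window phi s.+1 n.+1 =
      x 0 s + \sum_(0 <= j < n.+1) x j s.+1 - (x 0 s - phi (0 + s)%N)
      - (\sum_(0 <= j < n.+1) x j s.+1 - window phi s.+1 n.+1).
    by rewrite add0n; ring.
  by rewrite rpredB // rpredB.
have fr s : (s < n.+2)%N -> window f s r.+2 \in S.
  case: s => [_|s].
    rewrite windowSl fphi; last by lia.
    have := xS 0 0 isT isT; rewrite corner_first // => cS.
    have -> : f 0 + window phi 0 r.+1 =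
        (\sum_(0 <= j < n.+1) x j 0 - window phi 0 n.+1)
        - (\sum_(0 <= b < r.+1) x 0 b - window phi 0 r.+1)
        - (\sum_(0 <= j < n.+1) x j 0 - \sum_(0 <= b < r.+1) x 0 b).
      by rewrite [f 0]/=; ring.
    by rewrite rpredB // rpredB ?row ?col.
  rewrite !ltnS leq_eqVlt => /predU1P[-> | lt_s].
    rewrite windowS fphi // addSn flast.
    have := xS n r (leqnn _) (leqnn _); rewrite corner_last => cS.
    have -> : window phi n r.+1 - window phi r n.+1 =
        (\sum_(0 <= j < n.+1) x j r - window phi r n.+1)
        - (\sum_(0 <= b < r.+1) x n b - window phi n r.+1)
        + (\sum_(0 <= b < r.+1) x n b - \sum_(0 <= j < n.+1) x j r).
      by ring.
    by rewrite rpredD // rpredB ?row ?col.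
  rewrite fphi; last by lia.
  have := xB s 0 s.+1 0 (ltnW lt_s) isT lt_s isT.
  rewrite corner_row_diff // big_nat1 => cS.
  have := xphi 0 s (ltnW lt_s) isT; have := row s.+1 r.+1 lt_s (leqnn _).
  move=> rowS phiS; rewrite windowSl.
  have -> : phi s + window phi s.+1 r.+1 =
      x s 0 + \sum_(0 <= b < r.+1) x s.+1 b - (x s 0 - phi (s + 0)%N)
      - (\sum_(0 <= b < r.+1) x s.+1 b - window phi s.+1 r.+1).
    by rewrite addn0; ring.
  by rewrite rpredB // rpredB.
have [g [fg gn gr]] := window_lift fn fr.
exists (fun i a => g (i + a).+1) => i a lt_i lt_a.
  exact: corner_window0.
have -> : x i a - g (i + a).+1 =
    (x i a - phi (i + a)%N) + (f (i + a).+1 - g (i + a).+1).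
  by rewrite /f ifN; [ring | lia].
by rewrite rpredD ?xphi ?fg //; lia.
Qed.

(** * The two matrices as corner sum operators, and liftability of their kernels *)

Definition corner_coef (i a j b : nat) : int :=
  ((i <= j) && (b <= a))%N%:R - ((j <= i) && (a <= b))%N%:R.

Lemma corner_coefE n r (x : nat -> nat -> int) i a : (i < n)%N -> (a < r)%N ->
  \sum_(j < n) \sum_(b < r) corner_coef i a j b * x j b = corner n r x i a.
Proof.
move=> lt_i lt_a; rewrite /corner.
have natrM_if (c c' : bool) (y : int) :
    (c && c')%:R * y = if c then if c' then y else 0 else 0.
  by case: c c' => [] []; rewrite ?mul1r ?mul0r.
under eq_bigr do under eq_bigr do rewrite mulrBl !natrM_if.
under eq_bigr do rewrite sumrB.
rewrite sumrB; congr (_ - _).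
  rewrite big_geq_mkord [RHS]big_mkcond /=; apply: eq_bigr => j _.
  case: ifP => _; last by rewrite big1.
  by rewrite big_mkord (big_ord_widen r (x j)) // [RHS]big_mkcond.
rewrite big_mkord (big_ord_widen n (fun j => \sum_(a <= b < r) x j b)) //.
rewrite [RHS]big_mkcond; apply: eq_bigr => j _ /=; rewrite ltnS.
case: ifP => _; last by rewrite big1.
by rewrite big_geq_mkord [RHS]big_mkcond.
Qed.

Lemma H_IE n r s t :
  H_I n r s t = corner_coef (tagnat.sig1 s) (tagnat.sig2 s)
                            (tagnat.sig1 t) (tagnat.sig2 t).
Proof.
rewrite /corner_coef !mxE.
by case: (ltngtP (tagnat.sig1 s) (tagnat.sig1 t)) => _; rewrite !mxE;
   case: (ltngtP (tagnat.sig2 s) (tagnat.sig2 t)) => _.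
Qed.

(** Exchanging [M] and [- M^T] off the diagonal amounts to reversing the order of the blocks, while
    the order inside each block is kept. *)
Lemma H_IIE n r s t :
  H_II n r s t =
    corner_coef (rev_ord (tagnat.sig1 s)) (tagnat.sig2 s)
                (rev_ord (tagnat.sig1 t)) (tagnat.sig2 t).
Proof.
rewrite /corner_coef !leq_sub2lE // !ltnS !mxE.
by case: (ltngtP (tagnat.sig1 s) (tagnat.sig1 t)) => _; rewrite !mxE;
   case: (ltngtP (tagnat.sig2 s) (tagnat.sig2 t)) => _.
Qed.

(** Equivalent to torsion-freeness of the cokernel of [J]: whenever [J x = d y] with [d] nonzero,
    [y] is in the image of [J]. *)
Definition kernel_liftable (N : nat) (J : 'M[int]_N) : Prop :=
  forall (d : int) (x : 'cV_N), (forall s, (J *m x) s 0 \in dvdz d) ->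
  exists w : 'cV_N, J *m (x - d *: w) = 0.

Lemma sum_tagnat (V : nmodType) n r (F : 'I_n -> 'I_r -> V) :
  \sum_(t < \sum_(i < n) r) F (tagnat.sig1 t) (tagnat.sig2 t) =
    \sum_j \sum_b F j b.
Proof. by rewrite sig_big_dep (reindex _ tagnat.sig_bij_on). Qed.

Lemma corner_kernel_liftable n r (rho : 'I_n -> 'I_n)
    (J : 'M[int]_(\sum_(i < n) r)) : involutive rho ->
    (forall s t, J s t =
       corner_coef (rho (tagnat.sig1 s)) (tagnat.sig2 s)
                   (rho (tagnat.sig1 t)) (tagnat.sig2 t)) ->
  kernel_liftable J.
Proof.
move=> rhoK JE d x dvJx.
pose flat (y : nat -> nat -> int) : 'cV[int]_(\sum_(i < n) r) :=
  \col_s y (rho (tagnat.sig1 s)) (tagnat.sig2 s).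
have flatE y s : (J *m flat y) s 0 =
    corner n r y (rho (tagnat.sig1 s)) (tagnat.sig2 s).
  rewrite -corner_coefE // mxE [RHS](reindex_inj (inv_inj rhoK)) -(@sum_tagnat int) /=.
  by apply: eq_bigr => t _; rewrite JE mxE.
have [y xE] : exists y, x = flat y.
  (* [inord] needs inhabited index types; if [n] or [r] is 0, the vector has no entries. *)
  case: n rho rhoK J JE x dvJx @flat {flatE} => [|n] rho rhoK J JE x dvJx flat.
    by exists (fun _ _ => 0); apply/colP=> s; case: (tagnat.sig1 s).
  case: r J JE x dvJx @flat => [|r] J JE x dvJx flat.
    by exists (fun _ _ => 0); apply/colP=> s; case: (tagnat.sig2 s).
  exists (fun j b => x (tagnat.Rank (rho (inord j)) (inord b)) 0).
  by apply/colP => s; rewrite mxE !inord_val rhoK tagnat.sig2K.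
have cornerS i a : (i < n)%N -> (a < r)%N -> corner n r y i a \in dvdz d.
  move=> lt_i lt_a.
  have := dvJx (tagnat.Rank (rho (Ordinal lt_i)) (Ordinal lt_a)).
  by rewrite xE flatE tagnat.Rank1K tagnat.Rank2K rhoK.
have [z z0 zy] := corner_lift cornerS.
(* The division is exact by [zy], so subtracting [d] times this vector from [x] leaves [flat z], a
   kernel vector. *)
exists (\col_s divz (x s 0 - flat z s 0) d).
have -> : x - d *: (\col_s divz (x s 0 - flat z s 0) d) = flat z.
  apply/colP => s; rewrite !mxE mulrC divzK ?xE ?mxE; first by ring.
  exact: zy.
by apply/colP => s; rewrite flatE mxE z0.
Qed.

Lemma H_I_kernel_liftable n r : kernel_liftable (H_I n r).
Proof. by apply: (@corner_kernel_liftable _ _ id) => // s t; apply: H_IE. Qed.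

Lemma H_II_kernel_liftable n r : kernel_liftable (H_II n r).
Proof. by apply: (corner_kernel_liftable (@rev_ordK n)) => s t; apply: H_IIE. Qed.

(** * Congruence invariance and invertibility of the block entries *)

Lemma kernel_liftable_congruent N (J L : 'M[int]_N) :
  L \in unitmx -> kernel_liftable J -> kernel_liftable (L^T *m J *m L).
Proof.
move=> Lu Jlift d x dvx.
have [|w Jw0] := Jlift d (L *m x).
  move=> s; rewrite -[J *m _](mulKmx (_ : L^T \in unitmx)) ?unitmx_tr //.
  rewrite mxE; apply: rpred_sum => t _; rewrite dvdz_mull //.
  by rewrite -!mulmxA in dvx.
exists (invmx L *m w).
rewrite -!mulmxA mulmxBr -scalemxAr mulKVmx //.
by rewrite Jw0 !mulmx0.
Qed.

(** Since [D e_b = D a b *: e_a] vanishes modulo [D a b], some [e_b - D a b *: w] is in the kernel.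
    Row [a] of this equation gives [D a b * w_b = 1] after cancelling [D a b]. *)
Lemma kernel_liftable_isolated_entry N (D : 'M[int]_N) a b :
    kernel_liftable D -> D a b != 0 ->
    (forall c, c != b -> D a c = 0) -> (forall c, c != a -> D c b = 0) ->
  D a b \is a GRing.unit.
Proof.
move=> Dlift Dab0 rowD colD.
have De : D *m delta_mx b 0 = D a b *: delta_mx a (0 : 'I_1).
  apply/colP => c; rewrite -colE !mxE eqxx andbT.
  by case: eqVneq => [->|/colD ->]; rewrite ?mulr1 ?mulr0.
have [|w] := Dlift (D a b) (delta_mx b 0).
  by move=> s; rewrite De mxE dvdz_mulr.
rewrite mulmxBr -scalemxAr De -scalerBr => /colP/(_ a).
rewrite !mxE !eqxx /= => /eqP; rewrite mulf_eq0 (negPf Dab0) /= subr_eq0.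
rewrite (bigD1 b) //= big1 ?addr0 => [/eqP eq1|c /rowD ->]; last by rewrite mul0r.
by apply/unitrPr; exists (w b 0).
Qed.

Lemma mxdiag_skewE k (h : 'I_k -> int) (s t : 'I_(\sum_(i < k) 2)) :
  (\mxdiag_(i < k) skew_block (h i)) s t =
    if tagnat.sig1 s == tagnat.sig1 t
    then skew_block (h (tagnat.sig1 s)) (tagnat.sig2 s) (tagnat.sig2 t) else 0.
Proof. by rewrite mxE; case: eqP; rewrite ?conform_mx_id ?mxE. Qed.

Lemma skew_block_mxdiag_isolated k (h : 'I_k -> int) (i : 'I_k)
    (a := tagnat.Rank i (0 : 'I_2)) (b := tagnat.Rank i (1 : 'I_2))
    (D := \mxdiag_(i < k) skew_block (h i)) :
  [/\ D a b = h i, forall c, c != b -> D a c = 0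
                 & forall c, c != a -> D c b = 0].
Proof.
(* Within block [i], the only other index of row [a] or column [b] is a diagonal position, where the
   skew block is 0. *)
have sig2_neq (x : 'I_2) t : t != tagnat.Rank i x -> i = tagnat.sig1 t ->
    tagnat.sig2 t != x :> nat.
  move=> neq_t si; apply: contraNneq neq_t => s2; apply/eqP.
  rewrite -[t]tagnat.sig2K -si; congr tagnat.Rank; exact: val_inj.
split=> [|c neq_c|c neq_c]; rewrite mxdiag_skewE !tagnat.Rank1K.
- by rewrite eqxx mxE !tagnat.Rank2K.
- case: eqP => // /(sig2_neq _ _ neq_c); rewrite mxE tagnat.Rank2K /=.
  by case: (tagnat.sig2 c) => [[|[|]]].
- case: eqP => // /esym/(sig2_neq _ _ neq_c); rewrite mxE tagnat.Rank2K /=.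
  by case: (tagnat.sig2 c) => [[|[|]]].
Qed.

Theorem corollary4p10 (n r : nat) (hn : (0 < n)%N) (hr : (0 < r)%N)
    (J : 'M[int]_(\sum_(i < n) r)) (hJ : J = H_I n r \/ J = H_II n r)
    (L : 'M[int]_(\sum_(i < n) r)) (k : nat) (h : 'I_k -> int)
    (hL : is_block_diagonal_form J L h) (i : 'I_k) :
  skew_block (h i) = skew_block 1 \/ skew_block (h i) = skew_block (-1).
Proof.
have Jlift : kernel_liftable J.
  by case: hJ => ->; [apply: H_I_kernel_liftable | apply: H_II_kernel_liftable].
have [detL h0 [e LJL]] := hL.
have Lu : L \in unitmx by rewrite unitmxE; case: detL => ->.
have hi0 : h i != 0.
  apply: contraNneq (h0 i) => ->; apply/eqP/matrixP => x y.
  by rewrite !mxE oppr0 !if_same.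
(* The indices of the non-trivial blocks, transported along [e]; all remaining indices belong to the
   zero part. *)
pose emb s := cast_ord e (lshift (corank J) s).
pose a := tagnat.Rank i (0 : 'I_2); pose b := tagnat.Rank i (1 : 'I_2).
have [Dab rowD colD] := skew_block_mxdiag_isolated h i.
have embE c : (exists t, c = emb t) \/ (exists t, c = cast_ord e (rshift _ t)).
  case: (split_ordP (cast_ord (esym e) c)) => t ct; [left | right]; exists t;
  by rewrite /emb -ct cast_ordKV.
have Eab : (L^T *m J *m L) (emb a) (emb b) = h i.
  by rewrite LJL castmxE !cast_ordK block_mxEul.
have : h i \is a GRing.unit.
  rewrite -Eab; apply: kernel_liftable_isolated_entry; rewrite ?Eab //.
  - exact: kernel_liftable_congruent.
  - move=> c; rewrite LJL castmxE.
    case: (embE c) => [[t ->]|[t ->]] neq_c; rewrite !cast_ordK.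
      by rewrite block_mxEul rowD //; apply: contraNneq neq_c => ->.
    by rewrite block_mxEur mxE.
  - move=> c; rewrite LJL castmxE.
    case: (embE c) => [[t ->]|[t ->]] neq_c; rewrite !cast_ordK.
      by rewrite block_mxEul colD //; apply: contraNneq neq_c => ->.
    by rewrite block_mxEdl mxE.
case/orP=> /eqP ->; [by left | by right].
Qed.
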